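(* For every integer $\alpha\ge 1$ there exists an integer $n\ge 1$ such that for every graph $G$: if $G$ has a tree-cut decomposition $(T,\mathcal{X})$ of adhesion less than $\alpha$ such that, for every $t\in V(T)$, the torso of $(G,T,\mathcal{X})$ at $t$ is $\alpha$-basic, then $G$ does not contain the complete graph $K_n$ as a strong immersion.
   Context: Graphs are finite and may have parallel edges and loops (each loop contributes $2$ to the degree of its vertex); $K_n$ is the simple complete graph on $n$ vertices. Strong immersion. An immersion of $H$ in $G$ is a function $\theta$ on the vertices and edges of $H$ such that: (i) $\theta(v)\in V(G)$ for each $v\in V(H)$, and $\theta$ restricted to $V(H)$ is injective; (ii) $\theta(e)$ is a connected subgraph of $G$ for each $e\in E(H)$, and $\theta(e),\theta(f)$ are edge-disjoint for distinct $e,f\in E(H)$; (iii) if $e\in E(H)$ is incident with $v\in V(H)$, then $\theta(v)$ is a vertex of $\theta(e)$, and if $e$ is a loop, then $\theta(e)$ contains a cycle passing through $\theta(v)$ (a loop or a pair of parallel edges counts as a cycle). The immersion is strong if moreover, whenever $e\in E(H)$ is not incident with $v\in V(H)$, $\theta(e)$ does not contain $\theta(v)$. ''$G$ contains $H$ as a strong immersion'' means such a strong $\theta$ exists. Path-like decompositions. A near-partition of a set $Z$ is a family of pairwise disjoint, possibly empty, subsets of $Z$ with union $Z$. For $X\subseteq V(G)$, a path-like decomposition $\mathcal{P}$ of $G$ with respect to $X$ is an ordering $x_1,\dots,x_t$ of the vertices of $X$ together with a near-partition $B_0,\dots,B_t$ of $V(G)\setminus X$; the sets $B_i$ are its bags.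 The $x_i$-cut is the set of edges of $G$ with one endpoint in $\{x_1,\dots,x_{i-1}\}\cup B_0\cup\dots\cup B_{i-1}$ and the other endpoint in $\{x_{i+1},\dots,x_t\}\cup B_i\cup\dots\cup B_t$. The width of $\mathcal{P}$ is the maximum size of an $x$-cut over $x\in X$ (it is $0$ if $X=\emptyset$). For a set $Z$ of vertices, $b_{\mathcal{P}}(Z)$ is the number of bags of $\mathcal{P}$ that intersect $Z$; for an integer $p\ge 0$, $Z$ is $p$-bounded in $\mathcal{P}$ if $|X\cap Z|+b_{\mathcal{P}}(Z)\le p$. Linear sets and basic graphs. A set $W\subseteq V(G)$ is $\alpha$-linear if there exists $A\subseteq W$ with $|A|\le\alpha$ such that $G-A$ has a path-like decomposition $\mathcal{P}$ with respect to $W\setminus A$ of width less than $\alpha$ and the neighborhood (in $G$) of every vertex of $A$ is $\alpha$-bounded in $\mathcal{P}$. A graph is $\alpha$-basic if the set of all its vertices of degree at least $\alpha$ is $\alpha$-linear. Tree-cut decompositions. For $X\subseteq V(G)$, $\delta(X)$ is the set of edges with one endpoint in $X$ and the other not in $X$. A tree-cut decomposition of $G$ is a pair $(T,\mathcal{X})$ where $T$ is a tree and $\mathcal{X}=\{X_t\subseteq V(G): t\in V(T)\}$ is a near-partition of $V(G)$ indexed by $V(T)$ (bags $X_t$ may be empty). For $uv\in E(T)$, let $T_v$ be the component of $T-uv$ containing $v$. The adhesion of $(T,\mathcal{X})$ is $\max_{uv\in E(T)}\left|\delta\left(\bigcup_{t\in V(T_v)}X_t\right)\right|$ if $T$ has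 at least one edge, and $0$ otherwise. Torsos. Consolidating a set $X\subseteq V(G)$ means identifying the vertices of $X$ to a single vertex $v_X$ and deleting all loops incident to $v_X$ (parallel edges are kept). For $t\in V(T)$, the torso of $(G,T,\mathcal{X})$ at $t$ is $G$ itself if $|V(T)|=1$; otherwise, letting $T_1,\dots,T_l$ be the components of $T-t$ and $Z_i=\bigcup_{x\in V(T_i)}X_x$, it is the graph obtained from $G$ by consolidating each $Z_i$ to a single vertex $z_i$. *)

(* Defs.v *)
From mathcomp Require Import all_boot.

Set Implicit Arguments.
Unset Strict Implicit.
Unset Printing Implicit Defensive.

(* The two ends of an edge are stored as an ordered pair, but every notion below
   is symmetric in [src] and [tgt]: the graphs are undirected. *)
Record mgraph := MGraph {
  vertex :> finType;
  edge : finType;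
  src : edge -> vertex;
  tgt : edge -> vertex
}.

Definition incident (G : mgraph) (e : edge G) (v : G) : bool :=
  (src e == v) || (tgt e == v).

Definition is_loop (G : mgraph) (e : edge G) : bool := src e == tgt e.

(* A loop at [v] is counted once in each summand. *)
Definition deg_in (G : mgraph) (F : {set edge G}) (v : G) : nat :=
  #|[set e in F | src e == v]| + #|[set e in F | tgt e == v]|.

Definition degree (G : mgraph) (v : G) : nat := deg_in [set: edge G] v.

Definition edges_between (G : mgraph) (L R : {set G}) : {set edge G} :=
  [set e | ((src e \in L) && (tgt e \in R)) || ((src e \in R) && (tgt e \in L))].

Definition cut_edges (G : mgraph) (X : {set G}) : {set edge G} :=
  edges_between X (~: X).

Definition neighborhood (G : mgraph) (v : G) : {set G} :=
  [set u | (u != v) && [exists e : edge G, incident e u && incident e v]].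

(* Adjacency in the graph with vertex set [S] and those edges of [F] that have
   both ends in [S]. *)
Definition adj_in (G : mgraph) (S : {set G}) (F : {set edge G}) : rel G :=
  fun x y => [&& x \in S, y \in S &
    [exists e in F, ((src e == x) && (tgt e == y)) ||
                    ((src e == y) && (tgt e == x))]].

Definition component_in (G : mgraph) (S : {set G}) (F : {set edge G}) (x : G) :
  {set G} := [set y | connect (adj_in S F) x y].

Definition connected_in (G : mgraph) (S : {set G}) (F : {set edge G}) : Prop :=
  S != set0 /\ {in S &, forall x y, connect (adj_in S F) x y}.

Record subgraph (G : mgraph) := Subgraph {
  sgV : {set G};
  sgE : {set edge G};
  sg_closed : forall e, e \in sgE -> src e \in sgV /\ tgt e \in sgV
}.

Definition sg_connected (G : mgraph) (S : subgraph G) : Prop :=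
  connected_in (sgV S) (sgE S).

(* Connected and 2-regular; a loop and a pair of parallel edges are cycles. *)
Definition sg_cycle (G : mgraph) (C : subgraph G) : Prop :=
  sg_connected C /\ forall v, v \in sgV C -> deg_in (sgE C) v = 2.

Definition sg_sub (G : mgraph) (C S : subgraph G) : Prop :=
  (sgV C \subset sgV S) /\ (sgE C \subset sgE S).

Definition is_tree (T : mgraph) : Prop :=
  connected_in [set: T] [set: edge T] /\ ~ exists C : subgraph T, sg_cycle C.

Definition complete_graph (n : nat) : mgraph :=
  @MGraph 'I_n {p : 'I_n * 'I_n | p.1 < p.2}
    (fun e => (val e).1) (fun e => (val e).2).

Record immersion (H G : mgraph) := Immersion {
  im_vertex : H -> G;
  im_edge : edge H -> subgraph G;
  im_vertex_inj : injective im_vertex;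
  im_edge_connected : forall e, sg_connected (im_edge e);
  im_edge_disjoint : forall e f, e != f ->
    [disjoint sgE (im_edge e) & sgE (im_edge f)];
  im_incident : forall e v, incident e v -> im_vertex v \in sgV (im_edge e);
  im_loop : forall e v, is_loop e -> incident e v ->
    exists C : subgraph G,
      [/\ sg_cycle C, sg_sub C (im_edge e) & im_vertex v \in sgV C]
}.

Definition strong (H G : mgraph) (theta : immersion H G) : Prop :=
  forall e v, ~~ incident e v ->
    im_vertex theta v \notin sgV (im_edge theta e).

Definition contains_strong_immersion (G H : mgraph) : Prop :=
  exists theta : immersion H G, strong theta.

Definition near_partition (I V : finType) (B : I -> {set V}) (Z : {set V}) : Prop :=
  (forall i j, i != j -> [disjoint B i & B j]) /\ \bigcup_i B i = Z.

(* The ordering is 0-based: [pl_order k] is x_(k+1), while [pl_bag k] is B_k. *)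
Record pathlike (G : mgraph) (X : {set G}) := PathLike {
  pl_order : 'I_#|X| -> G;
  pl_bag : 'I_#|X|.+1 -> {set G};
  pl_order_inj : injective pl_order;
  pl_order_im : [set pl_order i | i : 'I_#|X|] = X;
  pl_bag_part : near_partition pl_bag (~: X)
}.

Section PathLike.
Variables (G : mgraph) (X : {set G}) (P : pathlike X).

Definition pl_left (k : 'I_#|X|) : {set G} :=
  [set pl_order P i | i : 'I_#|X| & i < k]
    :|: \bigcup_(i < #|X|.+1 | i <= k) pl_bag P i.

Definition pl_right (k : 'I_#|X|) : {set G} :=
  [set pl_order P i | i : 'I_#|X| & k < i]
    :|: \bigcup_(i < #|X|.+1 | k < i) pl_bag P i.

Definition pl_cut (k : 'I_#|X|) : {set edge G} :=
  edges_between (pl_left k) (pl_right k).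

Definition pl_width : nat := \max_(k < #|X|) #|pl_cut k|.

Definition pl_nbags (Z : {set G}) : nat :=
  #|[set i | pl_bag P i :&: Z != set0]|.

Definition pl_bounded (p : nat) (Z : {set G}) : Prop :=
  #|X :&: Z| + pl_nbags Z <= p.

End PathLike.

Section DeleteVertices.
Variables (G : mgraph) (A : {set G}).

Definition del_edge : finType :=
  {e : edge G | (src e \notin A) && (tgt e \notin A)}.

Definition del_src (e : del_edge) : {v : G | v \notin A} :=
  exist _ (src (val e)) (proj1 (andP (valP e))).

Definition del_tgt (e : del_edge) : {v : G | v \notin A} :=
  exist _ (tgt (val e)) (proj2 (andP (valP e))).

Definition del_vertices : mgraph := MGraph del_src del_tgt.

Definition del_restrict (Z : {set G}) : {set del_vertices} :=
  [set v : {v : G | v \notin A} | val v \in Z].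

End DeleteVertices.

(* [del_restrict A W] is W \ A as a set of vertices of G - A. Neighbors of [a]
   lying in A are in neither X nor a bag, so restricting the neighborhood to
   G - A does not change the count. *)
Definition linear_set (G : mgraph) (alpha : nat) (W : {set G}) : Prop :=
  exists A : {set G},
    [/\ A \subset W, #|A| <= alpha &
      exists P : pathlike (del_restrict A W),
        pl_width P < alpha /\
        forall a, a \in A -> pl_bounded P alpha (del_restrict A (neighborhood a))].

Definition basic (alpha : nat) (G : mgraph) : Prop :=
  linear_set alpha [set v : G | alpha <= degree v].

(* Simultaneous consolidation of a family [Z] of sets (meant to be pairwise
   disjoint): the vertices are the [inl v] with [v] outside every [Z i], and one
   vertex [inr i] for each [i]. *)
Section Consolidate.
Variables (G : mgraph) (I : finType) (Z : I -> {set G}).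

Definition cons_ok (x : G + I) : bool :=
  if x is inl v then v \notin \bigcup_i Z i else true.

Definition cons_label (v : G) : G + I :=
  if [pick i | v \in Z i] is Some i then inr i else inl v.

Lemma cons_label_ok (v : G) : cons_ok (cons_label v).
Proof.
rewrite /cons_label; case: pickP => //= vZ.
by apply/negP => /bigcupP[i _]; rewrite vZ.
Qed.

Definition cons_vertex : finType := {x : G + I | cons_ok x}.

Definition cons_proj (v : G) : cons_vertex :=
  exist _ (cons_label v) (cons_label_ok v).

(* Only the edges that become loops at a consolidated vertex are deleted. *)
Definition cons_edge : finType :=
  {e : edge G | ~~ [exists i, (src e \in Z i) && (tgt e \in Z i)]}.

Definition consolidate : mgraph :=
  @MGraph cons_vertex cons_edge
    (fun e => cons_proj (src (val e))) (fun e => cons_proj (tgt (val e))).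

End Consolidate.

Definition tree_cut_decomposition (G T : mgraph) (X : T -> {set G}) : Prop :=
  is_tree T /\ near_partition X [set: G].

Section TreeCut.
Variables (G T : mgraph) (X : T -> {set G}).

(* The choice of [tgt e] rather than [src e] is immaterial: the two sides of
   T - e give complementary subsets of V(G). *)
Definition edge_side (e : edge T) : {set G} :=
  \bigcup_(t in component_in [set: T] [set~ e] (tgt e)) X t.

Definition adhesion : nat := \max_(e : edge T) #|cut_edges (edge_side e)|.

Definition components_minus (t : T) : {set {set T}} :=
  [set component_in [set~ t] [set: edge T] x | x in [set~ t]].

Definition comp_part (t : T) (C : {C : {set T} | C \in components_minus t}) :
  {set G} := \bigcup_(x in val C) X x.

Definition torso (t : T) : mgraph :=
  if #|vertex T| == 1 then G else consolidate (@comp_part t).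

End TreeCut.

(* Main.v *)
Require Import Defs.
From mathcomp Require Import all_boot zify.

(** Everything rests on counting edges across a cut. If a set [S] of vertices
    of [G] contains the branch vertex of [i] but not those of the [d] in [D],
    then the images of the edges [id] of [K_n] are connected, edge-disjoint and
    each have an edge in the cut of [S], so this cut has at least [#|D|] edges
    ([fan_leq]).

    The tree-cut decomposition is disposed of first. Two distinct nodes of the
    tree are separated by one of its edges, whose cut has fewer than [alpha]
    edges; if two branch vertices were in bags on different sides, one of them
    would send an edge across to at least half of the branch vertices. Hence all
    branch vertices lie in a single bag [X t] ([branch_same_bag]), and
    consolidating sets which avoid the branch vertices preserves a strong
    immersion of a loopless graph, so the torso at [t] contains [K_n] as a
    strong immersion ([torso_immersion]).

    It remains to see that an [alpha]-basic graph [H] does not contain [K_n]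
    ([basic_no_immersion]). Branch vertices have large degree, so those outside
    the exceptional set [A], that is all but at most [alpha], are on the ordered
    list of the path-like decomposition of [H - A]. The sequence
    [B_0, x_1, B_1, ..., x_t, B_t] gives a linear position to every vertex of
    [H - A] ([pathlike_position]), and the neighborhoods of the vertices of [A]
    occupy at most [alpha ^ 2] positions. As there are more than
    [2 * alpha ^ 2 + 2] branch vertices on the list, there are three consecutive
    ones [l], [c], [r] such that no neighbor of [A] is strictly between [l] and
    [r] ([sorted_gap]). Let [S] be the set of vertices strictly between [l] and
    [r]; its only branch vertex is that of [c]. The image of an edge [cd] with
    [d] other than [l] and [r] has to leave [S]; it cannot do so through [A],
    which has no neighbor in [S], nor through [l] or [r], because the immersion
    is strong. So it uses an edge of the cut at [l] or of the cut at [r], and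
    there are fewer than [2 * alpha] of those, against [n - 3] choices of
    [d]. *)

Set Implicit Arguments.
Unset Strict Implicit.
Unset Printing Implicit Defensive.

(** * Cuts and adjacency *)

Lemma in_cut_edges (G : mgraph) (S : {set G}) (f : edge G) :
  (f \in cut_edges S) = ((src f \in S) != (tgt f \in S)).
Proof. by rewrite !inE; case: (_ \in S); case: (_ \in S). Qed.

Lemma cut_edges_degree (G : mgraph) (v : G) : #|cut_edges [set v]| <= degree v.
Proof.
rewrite /degree /deg_in.
apply: (leq_trans _ (leq_card_setU _ _)); apply/subset_leq_card/subsetP => f.
by rewrite in_cut_edges !inE; case: (src f == v) => //=; case: (tgt f == v).
Qed.

Lemma adj_in_ends (G : mgraph) (S : {set G}) (F : {set edge G}) (f : edge G) :
  f \in F -> src f \in S -> tgt f \in S -> adj_in S F (src f) (tgt f).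
Proof.
move=> fF fs ft; rewrite /adj_in fs ft; apply/existsP; exists f.
by rewrite fF !eqxx.
Qed.

Lemma adj_in_sym (G : mgraph) (S : {set G}) (F : {set edge G}) :
  symmetric (adj_in S F).
Proof.
move=> x y; rewrite /adj_in andbCA; do 2 congr (_ && _).
by apply: eq_existsb => f; rewrite orbC.
Qed.

Lemma adj_inP (G : mgraph) (S : {set G}) (F : {set edge G}) (x y : G) :
  adj_in S F x y ->
  [/\ x \in S, y \in S & exists2 f, f \in F &
    (src f = x /\ tgt f = y) \/ (src f = y /\ tgt f = x)].
Proof.
case/and3P=> xS yS /existsP[f /andP[fF /orP ends]]; split=> //; exists f => //.
by case: ends => /andP[/eqP-> /eqP->]; [left | right].
Qed.

Lemma connect_cut (G : mgraph) (S I : {set G}) (F : {set edge G}) (x y : G) :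
  connect (adj_in S F) x y -> (x \in I) != (y \in I) ->
  exists2 f, f \in F & f \in cut_edges I.
Proof.
move=> xy; case: (boolP [exists f in F, f \in cut_edges I]) => [/exists_inP//|noF].
rewrite (closed_connect (a := mem I) _ xy) ?eqxx // => u v /adj_inP[_ _ [f fF uv]].
move/exists_inPn: noF => /(_ f fF); rewrite in_cut_edges negbK => /eqP.
by case: uv => -[-> ->].
Qed.

Lemma connect_adj_in_mono (G : mgraph) (S S' : {set G}) (F F' : {set edge G}) x y :
  S \subset S' -> F \subset F' ->
  connect (adj_in S F) x y -> connect (adj_in S' F') x y.
Proof.
move=> /subsetP sS /subsetP sF; apply: connect_sub => u v.
case/adj_inP => /sS uS /sS vS [f /sF fF uv]; apply: connect1.
by case: uv (uS) (vS) => -[<- <-] ? ?; [|rewrite adj_in_sym]; apply: adj_in_ends.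
Qed.

(** * Cuts crossed by an immersed complete graph *)

Lemma complete_edge n (i d : 'I_n) : d != i ->
  exists e : edge (complete_graph n),
    forall k : 'I_n, incident e k = (k == i) || (k == d).
Proof.
rewrite -val_eqE neq_ltn => /orP[lt|lt].
- exists (exist _ (d, i) lt) => k; rewrite /incident /= orbC.
  by rewrite !(eq_sym k).
- exists (exist _ (i, d) lt) => k; rewrite /incident /=.
  by rewrite !(eq_sym k).
Qed.

(** Choosing for each [d] in [D] an edge of the cut in the image of [id] is
    injective, as images are edge-disjoint. The set [C] stands for the whole cut
    or for a smaller set which, for reasons specific to the immersion, already
    contains all those edges. *)
Lemma fan_leq n (G : mgraph) (theta : immersion (complete_graph n) G)
    (i : 'I_n) (D : {set 'I_n}) (S : {set G}) (C : {set edge G}) :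
  (forall d, d \in D ->
     (im_vertex theta i \in S) != (im_vertex theta d \in S)) ->
  (forall (d : 'I_n) (e : edge (complete_graph n)) f, d \in D ->
     (forall k : 'I_n, incident e k = (k == i) || (k == d)) ->
     f \in sgE (im_edge theta e) -> f \in cut_edges S -> f \in C) ->
  #|D| <= #|C|.
Proof.
move=> DS DC.
have Di d : d \in D -> d != i by move/DS; apply: contraNneq => ->.
have pickf (d : {d | d \in D}) : exists f, f \in C /\
    exists2 e : edge (complete_graph n),
        (forall k : 'I_n, incident e k = (k == i) || (k == val d)) &
               f \in sgE (im_edge theta e).
  have [e eP] := complete_edge (Di _ (valP d)).
  have [_ conn] := im_edge_connected theta e.
  have ie : incident e i by rewrite eP eqxx.
  have de : incident e (val d) by rewrite eP eqxx orbT.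
  have [f fe fS] := connect_cut
    (conn _ _ (im_incident theta ie) (im_incident theta de)) (DS _ (valP d)).
  by exists f; split; [exact: DC (valP d) eP fe fS | exists e].
have [g gP] := fin_all_exists pickf.
have g_inj : injective g.
  move=> d d' gdd'; have [_ [e eP ge]] := gP d; have [_ [e' eP' ge']] := gP d'.
  have [ee'|/(im_edge_disjoint theta)/pred0P/(_ (g d))] := eqVneq e e'; last first.
    by rewrite /= ge gdd' ge'.
  apply/val_inj/eqP; have := eP (val d); rewrite ee' eP' eqxx orbT.
  by rewrite (negPf (Di _ (valP d))).
rewrite -card_sig -cardsT -(card_imset _ g_inj).
apply/subset_leq_card/subsetP => _ /imsetP[d _ ->].
by have [] := gP d.
Qed.

(** Either at least half of the branch vertices lie outside [S], and [i] sends
    an edge across to each of them, or at least half lie inside, and [j] does. *)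
Lemma separated_leq n (G : mgraph) (theta : immersion (complete_graph n) G)
    (i j : 'I_n) (S : {set G}) :
  im_vertex theta i \in S -> im_vertex theta j \notin S ->
  n <= #|cut_edges S|.*2.
Proof.
move=> iS jS; pose D : {set 'I_n} := [set d | im_vertex theta d \in S].
have leD : #|D| <= #|cut_edges S|.
  apply: (fan_leq (theta := theta) (i := j) (S := S)) => // d.
  by rewrite inE (negPf jS) => ->.
have leDC : #|~: D| <= #|cut_edges S|.
  apply: (fan_leq (theta := theta) (i := i) (S := S)) => // d.
  by rewrite !inE iS => /negPf->.
by rewrite -[n in n <= _]card_ord -(cardsC D) -addnn leq_add.
Qed.

Lemma branch_degree n (G : mgraph) (theta : immersion (complete_graph n) G)
    (i : 'I_n) : n.-1 <= degree (im_vertex theta i).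
Proof.
apply: leq_trans (cut_edges_degree _); have := cardsC1 i; rewrite card_ord => <-.
apply: (fan_leq (theta := theta) (i := i) (S := [set im_vertex theta i])) => // d.
by rewrite !inE eqxx => di; rewrite (inj_eq (@im_vertex_inj _ _ theta)) (negPf di).
Qed.

(** * Immersions in basic graphs *)

(** The open intervals between the entries of even index of [s] are disjoint and
    outnumber [M]. In the induction, if an element of [M] is in the first one,
    dropping two entries of [s] also loses that element. *)
Lemma sorted_gap (s M : seq nat) :
  sorted ltn s -> (size M).*2 + 2 < size s ->
  exists l c r, [/\ l \in s, c \in s & r \in s] /\
    [/\ l < c < r, forall x, x \in s -> l < x < r -> x = c &
        forall m, m \in M -> ~~ (l < m < r)].
Proof.
have [k] := ubnP (size M); elim: k s M => // k IH s M ltk s_sorted lts.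
case: s s_sorted lts => [|a [|b [|c s]]] //=; try lia.
move=> /and3P[ab bc cs] lts.
have c_min x : x \in s -> c < x.
  by move: cs; rewrite path_sortedE; [move/andP=> [/allP cx _] /cx | apply: ltn_trans].
have [/hasP[m0 m0M /andP[_ m0c]] | noM] := boolP (has (fun m => a < m < c) M).
- pose M' := [seq m <- M | c < m].
  have ltM : size M' < size M.
    rewrite size_filter -(count_predC (fun m => c < m) M) -[X in X < _]addn0 ltn_add2l.
    by rewrite -has_count; apply/hasP; exists m0 => //=; lia.
  have [||| l [d [r [[ls ds rs] [ldr dP M'P]]]]] := IH (c :: s) M' => //=; try lia.
  have cl x : x \in c :: s -> c <= x by rewrite inE => /predU1P[->|/c_min/ltnW].
  exists l, d, r; split.
    by split; rewrite in_cons [X in _ || X]in_cons ?ls ?ds ?rs !orbT.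
  have := cl l ls => lecl; split=> // [x|m mM].
    rewrite 2!inE => /predU1P[->|/predU1P[->|]]; try lia.
    exact: dP.
  apply/negP => /andP[lm mr]; have := M'P m.
  by rewrite mem_filter mM lm mr (leq_ltn_trans lecl lm) => /(_ isT).
- exists a, b, c; rewrite !inE !eqxx !orbT; split=> //; rewrite ab bc; split=> // [x|m mM].
    rewrite !inE => /predU1P[->|/predU1P[->|/predU1P[->|/c_min]]] //; lia.
  by move/hasPn: noM => /(_ m mM).
Qed.

(** The position of [x_k] is [2k - 1] and that of a vertex of [B_i] is [2i]: this
    is reading [B_0, x_1, B_1, ..., x_t, B_t] from left to right. *)
Lemma pathlike_position (G : mgraph) (X : {set G}) (P : pathlike X) :
  exists pos : G -> 'I_(#|X|.*2.+1),
  [/\ forall x u, x \in X -> pos u = pos x -> u = x,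
      forall x, x \in X -> exists C : {set edge G}, #|C| <= pl_width P /\
        forall f, (pos (src f) < pos x < pos (tgt f)) ||
                  (pos (tgt f) < pos x < pos (src f)) -> f \in C &
      forall Z : {set G}, #|pos @: Z| <= #|X :&: Z| + pl_nbags P Z].
Proof.
have [_ cover] := pl_bag_part P.
have in_order v : v \in X -> exists k, pl_order P k = v.
  by rewrite -[in v \in X](pl_order_im P) => /imsetP[k _ ->]; exists k.
have in_bag v : v \notin X -> exists i, v \in pl_bag P i.
  by rewrite -in_setC -cover => /bigcupP[i _ vi]; exists i.
have order_X k : pl_order P k \in X.
  by rewrite -[in X in _ \in X](pl_order_im P) imset_f.
have odd_lt (k : 'I_#|X|) : k.*2.+1 < #|X|.*2.+1 by have := ltn_ord k; lia.
have even_lt (i : 'I_#|X|.+1) : i.*2 < #|X|.*2.+1 by have := ltn_ord i; lia.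
(* [pl_order P k] is [x_(k+1)], whence its position [2k + 1]. *)
pose at_pos v (p : 'I_(#|X|.*2.+1)) :=
  (exists2 k, v = pl_order P k & p = Ordinal (odd_lt k)) \/
  (exists2 i, v \in pl_bag P i & p = Ordinal (even_lt i)).
have /fin_all_exists[pos posP] v : exists p, at_pos v p.
  have [/in_order[k <-]|/in_bag[i vi]] := boolP (v \in X).
  - by exists (Ordinal (odd_lt k)); left; exists k.
  - by exists (Ordinal (even_lt i)); right; exists i.
have bag_X i v : v \in pl_bag P i -> v \notin X.
  by move=> vi; rewrite -in_setC -cover; apply/bigcupP; exists i.
have posX k : nat_of_ord (pos (pl_order P k)) = k.*2.+1.
  case: (posP (pl_order P k)) => [[k' /pl_order_inj<- ->] //|[i /bag_X]].
  by rewrite order_X.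
have left_pos (k : 'I_#|X|) v : pos v < k.*2.+1 -> v \in pl_left P k.
  rewrite inE; case: (posP v) => [[k' -> ->]|[i vi ->]] /= lt.
  - by apply/orP; left; apply: imset_f; rewrite inE; lia.
  - by apply/orP; right; apply/bigcupP; exists i => //; lia.
have right_pos (k : 'I_#|X|) v : k.*2.+1 < pos v -> v \in pl_right P k.
  rewrite inE; case: (posP v) => [[k' -> ->]|[i vi ->]] /= lt.
  - by apply/orP; left; apply: imset_f; rewrite inE; lia.
  - by apply/orP; right; apply/bigcupP; exists i => //; lia.
exists pos; split.
- move=> x u /in_order[k <-] /(congr1 (@nat_of_ord _)); rewrite posX.
  case: (posP u) => [[k' -> ->]|[i ui ->]] /=; last by lia.
  by move=> kk'; congr (pl_order P _); apply/val_inj => /=; lia.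
- move=> x /in_order[k <-]; exists (pl_cut P k); split.
    exact: (leq_bigmax (F := fun k => #|pl_cut P k|)).
  move=> f; rewrite posX inE => /orP[] /andP[/left_pos-> /right_pos->] //.
  by rewrite orbT.
- move=> Z.
  pose bags := [set i | pl_bag P i :&: Z != set0].
  pose even_pos i := Ordinal (even_lt i).
  have sub : pos @: Z \subset (pos @: (X :&: Z)) :|: (even_pos @: bags).
    apply/subsetP => _ /imsetP[v vZ ->]; rewrite inE.
    case: (posP v) => [[k vk _]|[i vi ->]].
    - by apply/orP; left; rewrite imset_f // inE vZ vk order_X.
    - apply/orP; right; rewrite (imset_f even_pos) // inE.
      by apply/set0Pn; exists v; rewrite inE vi.
  apply: leq_trans (subset_leq_card sub) _.
  by apply: leq_trans (leq_card_setU _ _) _; rewrite leq_add ?leq_imset_card.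
Qed.

Lemma leq_card_bigcup (I T : finType) (A : {set I}) (F : I -> {set T}) (b : nat) :
  (forall i, i \in A -> #|F i| <= b) -> #|\bigcup_(i in A) F i| <= #|A| * b.
Proof.
move=> Fb; rewrite -sum_nat_const.
apply: (big_ind2 (fun (S : {set T}) s => #|S| <= s)) => [|S s S' s' leS leS'|//].
- by rewrite cards0.
- by apply: leq_trans (leq_card_setU _ _) _; rewrite leq_add.
Qed.

(** The bound on [n] yields more than [2 * alpha ^ 2 + 2] branch vertices outside
    [A], as [sorted_gap] requires, and [n - 3 >= 2 * alpha] final choices of
    [d]. *)
Lemma basic_no_immersion (alpha : nat) (H : mgraph) (n : nat) :
  1 <= alpha -> 2 * alpha ^ 2 + 2 * alpha + 3 <= n ->
  basic alpha H -> ~ contains_strong_immersion H (complete_graph n).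
Proof.
move=> alpha_gt0 len [A [sAW cardA [P [widthP boundP]]]] [theta strong_theta].
pose th : 'I_n -> H := im_vertex theta.
have th_inj : injective th := @im_vertex_inj _ _ theta.
have [pos [pos_inj pos_cut pos_card]] := pathlike_position P.
set X := del_restrict A _ in P widthP boundP pos pos_inj pos_cut pos_card.
pose J : {set 'I_n} := [set i | th i \notin A].
have cardJ : n - alpha <= #|J|.
  have : #|~: J| <= alpha.
    rewrite -(card_imset _ th_inj); apply: leq_trans cardA.
    by apply/subset_leq_card/subsetP => _ /imsetP[i iA ->]; rewrite !inE negbK in iA.
  by have := cardsC J; rewrite card_ord; lia.
(* The default value, taken on [A] only, is always discarded. *)
pose p (v : H) : nat :=
  if insub v is Some u then nat_of_ord (pos (u : del_vertices A)) else 0.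
have pval (u : del_vertices A) : p (val u) = pos u by rewrite /p valK.
have thX i : i \in J -> exists2 x, x \in X & val x = th i.
  rewrite inE => iA; exists (exist _ (th i) iA : del_vertices A) => //.
  by rewrite !inE /=; apply: leq_trans (branch_degree theta i); lia.
have p_inj i v : i \in J -> v \notin A -> p v = p (th i) -> v = th i.
  move=> /thX[x xX <-] vA; rewrite -[v]/(val (exist _ v vA : del_vertices A)) !pval.
  by move/val_inj/pos_inj => ->.
(* The positions occupied by neighbors of [A]. *)
pose M := \bigcup_(a in A) pos @: del_restrict A (neighborhood a).
have cardM : #|M| <= alpha ^ 2.
  rewrite -mulnn; apply: leq_trans (leq_mul cardA (leqnn alpha)).
  apply: leq_card_bigcup => a aA; apply: leq_trans (pos_card _) _.
  exact: boundP.
pose Ms := [seq nat_of_ord m | m <- enum M].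
have sizeMs : size Ms = #|M| by rewrite size_map -cardE.
pose s := sort leq [seq p (th i) | i <- enum J].
have size_s : size s = #|J| by rewrite size_sort size_map -cardE.
have s_sorted : sorted ltn s.
  rewrite ltn_sorted_uniq_leq sort_uniq sort_sorted ?andbT; last exact: leq_total.
  rewrite map_inj_in_uniq ?enum_uniq // => i j; rewrite !mem_enum => iJ jJ eqp.
  by apply/th_inj/p_inj => //; rewrite inE in iJ.
have sP y : reflect (exists2 i, i \in J & y = p (th i)) (y \in s).
  rewrite mem_sort; apply: (iffP mapP) => -[i iJ ->]; exists i => //.
    by rewrite mem_enum in iJ.
  by rewrite mem_enum.
have [|? [? [? [[/sP[l lJ ->] /sP[c cJ ->] /sP[r rJ ->]]]]]] :=
  sorted_gap (M := Ms) s_sorted; first by rewrite size_s sizeMs; lia.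
case=> /andP[lc cr] between noM.
pose S := [set v : H | (v \notin A) && (p (th l) < p v < p (th r))].
have cS : th c \in S by move: cJ; rewrite !inE => ->; rewrite lc.
have [xl xlX xlE] := thX l lJ; have [xr xrX xrE] := thX r rJ.
have [Cl [cardCl ClP]] := pos_cut xl xlX; have [Cr [cardCr CrP]] := pos_cut xr xrX.
pose D := ~: [set l; c; r].
have cardD : n - 3 <= #|D|.
  have := cardsC [set l; c; r]; rewrite card_ord -/D.
  have : #|[set l; c; r]| <= 3; last lia.
  by apply: leq_trans (leq_card_setU _ _) _; rewrite cards1 cards2; case: (_ == _).
pose C := [set val f | f in Cl :|: Cr].
have : #|D| <= #|C|; last first.
  move=> leDC; have leC : #|C| <= #|Cl| + #|Cr|.
    exact: leq_trans (leq_imset_card _ _) (leq_card_setU _ _).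
  have : #|D| < 2 * alpha; last lia.
  apply: leq_ltn_trans leDC (leq_ltn_trans leC _).
  by move: (leq_ltn_trans cardCl widthP) (leq_ltn_trans cardCr widthP); lia.
apply: (fan_leq (theta := theta) (i := c) (S := S)).
(* [l], [c], [r] are consecutive, so [c] is the only branch vertex in [S]. *)
- move=> d; rewrite !inE -/(th c) -/(th d) !negb_or => /andP[/andP[dl dc] dr].
  move: cS; rewrite inE => ->; apply: contraNneq dc => /esym/andP[dA dS].
  have dJ : d \in J by rewrite inE.
  apply/eqP/th_inj/p_inj => //; apply: between => //.
  by apply/sP; exists d.
move=> d e f dD eP fe; rewrite in_cut_edges.
have /and3P[dl dc dr] : [&& d != l, d != c & d != r].
  by move: dD; rewrite !inE !negb_or andbA.
(* Strongness: apart from [c] and [d], branch vertices are not on the image. *)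
have avoid k u : k \in J -> (k == c) = false -> (k == d) = false ->
    u \in sgV (im_edge theta e) -> u \notin A -> p u != p (th k).
  move=> kJ kc kd ue uA; apply/eqP => /(p_inj _ _ kJ uA) uk.
  by have := strong_theta e k; rewrite eP kc kd -/(th k) -uk ue => /(_ isT).
(* Leaving [S], the image avoids [A], [l] and [r], so it jumps over [l] or [r]. *)
have crossing u v : incident f u -> incident f v -> u \in S -> v \notin S ->
    v \in sgV (im_edge theta e) -> v \notin A /\
    (p v < p (th l) \/ p (th r) < p v).
  move=> fu fv; rewrite !inE => /andP[uA up] vS vE.
  have vA : v \notin A.
    apply/negP => vA; have uv : u != v by apply: contraNneq uA => ->.
    have uM : pos (exist _ u uA : del_vertices A) \in M.
      apply/bigcupP; exists v => //; apply: imset_f; rewrite !inE /= uv.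
      by apply/existsP; exists f; rewrite fu fv.
    have /noM : p u \in Ms; last by rewrite up.
    rewrite -[u]/(val (exist _ u uA : del_vertices A)) pval.
    by rewrite map_f ?mem_enum.
  split=> //; move: vS; rewrite vA /= negb_and -!leqNgt.
  have := avoid l v lJ _ _ vE vA; have := avoid r v rJ _ _ vE vA.
  rewrite !(eq_sym _ d) (negPf dl) (negPf dr).
  have -> : (l == c) = false by apply/eqP => lc'; move: lc; rewrite lc' ltnn.
  have -> : (r == c) = false by apply/eqP => rc'; move: cr; rewrite rc' ltnn.
  move=> /(_ erefl erefl) vr /(_ erefl erefl) vl /orP[le|le]; [left | right].
  - by rewrite ltn_neqAle vl.
  - by rewrite ltn_neqAle eq_sym vr.
have inC u v : src f = u /\ tgt f = v \/ src f = v /\ tgt f = u ->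
    u \notin A -> v \notin A ->
    p (th l) < p u < p (th r) -> p v < p (th l) \/ p (th r) < p v -> f \in C.
  move=> ends uA vA up vp.
  have fA : (src f \notin A) && (tgt f \notin A).
    by case: ends => -[-> ->]; rewrite uA vA.
  pose f' : edge (del_vertices A) := exist _ f fA.
  have ps : p (src f) = pos (src f') := pval (src f').
  have pt : p (tgt f) = pos (tgt f') := pval (tgt f').
  have pl : p (th l) = pos xl by rewrite -xlE pval.
  have pr : p (th r) = pos xr by rewrite -xrE pval.
  apply/imsetP; exists f' => //; rewrite inE; apply/orP.
  case/andP: up => lu ur.
  case: vp => vp; [left; apply: ClP | right; apply: CrP];
    rewrite -ps -pt -?pl -?pr; case: ends => -[-> ->];
    by rewrite ?lu ?ur vp ?orbT.
have [fs ft] := sg_closed fe.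
have incs : incident f (src f) by rewrite /incident eqxx.
have inct : incident f (tgt f) by rewrite /incident eqxx orbT.
have [sS|sS] := boolP (src f \in S); have [tS|tS] //= := boolP (tgt f \in S) => _.
- have [tA tp] := crossing _ _ incs inct sS tS ft.
  by move: sS; rewrite inE => /andP[sA sp];
    exact: (inC _ _ (or_introl (conj erefl erefl)) sA tA sp tp).
- have [sA sp] := crossing _ _ inct incs tS sS fs.
  by move: tS; rewrite inE => /andP[tA tp];
    exact: (inC _ _ (or_intror (conj erefl erefl)) tA sA tp sp).
Qed.

(** * Edges of a tree separate its nodes *)

Lemma deg_in_setU1 (G : mgraph) (F : {set edge G}) (f : edge G) (v : G) :
  f \notin F ->
  deg_in (f |: F) v = (src f == v) + (tgt f == v) + deg_in F v.
Proof.
move=> fF.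
have count (g : edge G -> G) :
    #|[set e in f |: F | g e == v]| = (g f == v) + #|[set e in F | g e == v]|.
  have [gf|gf] := eqVneq (g f) v.
  - have -> : [set e in f |: F | g e == v] = f |: [set e in F | g e == v].
      by apply/setP => e; rewrite !inE andb_orl; case: eqP => //= ->; rewrite gf eqxx.
    by rewrite cardsU1 inE (negPf fF).
  - congr #|pred_of_set _|; apply/setP => e; rewrite !inE andb_orl.
    by case: eqP => //= ->; rewrite (negPf gf) andbF.
by rewrite /deg_in !count; lia.
Qed.

(** A path as a set of edges: its inner vertices have degree 2 and its ends
    degree 1. Adding both indicators of the ends covers the path with one vertex,
    whose degree is 0. *)
Lemma path_subgraph (G : mgraph) (F0 : {set edge G}) (x : G) (p : seq G) :
  path (adj_in [set: G] F0) x p -> uniq (x :: p) ->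
  exists F : {set edge G}, [/\ F \subset F0,
    forall f, f \in F -> src f \in x :: p /\ tgt f \in x :: p,
    {in x :: p, forall y, connect (adj_in [set:: x :: p] F) x y} &
    forall v, deg_in F v + (x == v) + (last x p == v) = 2 * (v \in x :: p)].
Proof.
elim: p x => [|y p IH] x.
  move=> _ _; exists set0; split=> [|f|z|v]; rewrite ?sub0set ?inE //.
  - by move=> /eqP->.
  - rewrite /deg_in [v == x]eq_sym.
    have no (g : edge G -> G) : [set e in set0 | g e == v] = set0.
      by apply/setP => e; rewrite !inE.
    by rewrite !no cards0; case: (x == v).
move=> /andP[/adj_inP[_ _ [f fF0 ends]] pth] /andP[xNp yp].
have [F [sF closedF connF degF]] := IH y pth yp.
have fF : f \notin F.
  by apply: contra xNp => /closedF[]; case: ends => -[-> ->].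
exists (f |: F); split.
- by rewrite subUset sub1set fF0.
- move=> g; rewrite !inE => /predU1P[->|/closedF[]]; last first.
    by rewrite !inE => -> ->; rewrite !orbT.
  by case: ends => -[-> ->]; rewrite !eqxx ?orbT.
- move=> z; rewrite inE => /predU1P[->|zp]; first exact: connect0.
  apply: (@connect_trans _ _ y).
    apply: connect1; case: ends => -[<- <-]; [|rewrite adj_in_sym];
    apply: adj_in_ends; rewrite !inE ?eqxx ?orbT //.
  apply: connect_adj_in_mono (connF z zp); last exact: subsetUr.
  by apply/subsetP => u; rewrite !inE => ->; rewrite orbT.
- move=> v; rewrite (deg_in_setU1 _ fF) /= inE.
  have -> : (src f == v) + (tgt f == v) = (x == v) + (y == v).
    by case: ends => -[-> ->] //; rewrite addnC.
  have := degF v; have [->|_] /= := eqVneq v x; rewrite ?eqxx ?(negPf xNp); lia.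
Qed.

(** Otherwise a simple path joining the ends of [e] in [T - e] forms a cycle with
    [e]; this includes the case of a loop, where the path has no edge. *)
Lemma tree_edge_bridge (T : mgraph) (e : edge T) :
  is_tree T -> ~~ connect (adj_in [set: T] [set~ e]) (src e) (tgt e).
Proof.
case=> _ acyclic; apply/negP => /connectP[p0 pth0 last0].
move: last0; have [p pth p_uniq _] := shortenP pth0 => lastp.
have [F [sF closedF connF degF]] := path_subgraph pth p_uniq.
have eF : e \notin F by apply/negP => /(subsetP sF); rewrite !inE eqxx.
have closedC f : f \in e |: F ->
    src f \in [set:: src e :: p] /\ tgt f \in [set:: src e :: p].
  rewrite inE => /setU1P[->|/closedF[]]; last by rewrite !inE.
  by rewrite !inE eqxx lastp -in_cons mem_last.
apply: acyclic; exists (Subgraph closedC); split; last first.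
  move=> v /=; rewrite inE => vp; rewrite (deg_in_setU1 _ eF).
  by have := degF v; rewrite -lastp vp; lia.
split=> /= [|y z]; first by apply/set0Pn; exists (src e); rewrite !inE eqxx.
have conn u : u \in [set:: src e :: p] ->
    connect (adj_in [set:: src e :: p] (e |: F)) (src e) u.
  rewrite inE => /connF; apply: connect_adj_in_mono => //; exact: subsetUr.
move=> /conn ey /conn ez; apply: connect_trans ez.
by rewrite (sym_connect_sym (@adj_in_sym _ _ _)).
Qed.

(** The first edge of a simple path from [s] to [t] works: the rest of the path
    avoids [s], hence this edge. *)
Lemma tree_edge_separates (T : mgraph) (s t : T) : is_tree T -> s != t ->
  exists e : edge T,
    (s \in component_in [set: T] [set~ e] (tgt e)) !=
    (t \in component_in [set: T] [set~ e] (tgt e)).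
Proof.
move=> tree; have [[_ conn] _] := tree.
have /connectP[p0 pth0 ->] := conn s t (in_setT _) (in_setT _).
have [p pth p_uniq _] := shortenP pth0.
case: p pth p_uniq => [|y p] /=; first by rewrite eqxx.
move=> /andP[/adj_inP[_ _ [e _ ends]] pth] /andP[sNp _] _; exists e.
have yt : connect (adj_in [set: T] [set~ e]) y (last y p).
  apply/connectP; exists p => //.
  apply: (sub_in_path (P := predC1 s)) pth; last first.
    by apply/allP => z zp; apply: contraNneq sNp => <-.
  move=> u v us vs /adj_inP[_ _ [f _ uv]].
  have fe : f \in [set~ e].
    rewrite !inE; apply/eqP => fe; move: us vs; rewrite !inE.
    by case: ends uv; rewrite fe => -[-> ->] [] [<- <-]; rewrite eqxx.
  by case: uv => -[<- <-]; [|rewrite adj_in_sym]; apply: adj_in_ends; rewrite ?in_setT.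
have symT := sym_connect_sym (adj_in_sym [set: T] [set~ e]).
have bridge := tree_edge_bridge e tree; rewrite !inE.
case: ends bridge => -[-> ->] bridge.
- by rewrite yt symT (negPf bridge).
- by rewrite connect0 [connect _ s (last y p)]symT -(same_connect symT yt) (negPf bridge).
Qed.

(** * From a tree-cut decomposition to a torso *)

Lemma near_partition_eq (I V : finType) (B : I -> {set V}) (Z : {set V}) i j v :
  near_partition B Z -> v \in B i -> v \in B j -> i = j.
Proof.
case=> disj _ vi vj; apply/eqP; apply: contraTT vj => /disj/disjointFr-> //.
Qed.

Lemma branch_same_bag n (G T : mgraph) (X : T -> {set G})
    (theta : immersion (complete_graph n) G) (i j : 'I_n) (s t : T) :
  tree_cut_decomposition X -> (adhesion X).*2 < n ->
  im_vertex theta i \in X s -> im_vertex theta j \in X t -> s = t.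
Proof.
case=> tree part small iX jX; apply/eqP/negPn/negP => st.
have [e ste] := tree_edge_separates tree st.
have side v r : v \in X r ->
    (v \in edge_side X e) = (r \in component_in [set: T] [set~ e] (tgt e)).
  move=> vr; apply/bigcupP/idP => [[r' r'C vr']|]; last by exists r.
  by rewrite (near_partition_eq part vr vr').
have leA : #|cut_edges (edge_side X e)| <= adhesion X.
  exact: (leq_bigmax (F := fun e => #|cut_edges (edge_side X e)|)).
have sep k l : im_vertex theta k \in edge_side X e ->
    im_vertex theta l \in edge_side X e.
  by move=> kS; apply/negPn/negP => lS; have := separated_leq kS lS; lia.
case/eqP: ste; rewrite -(side _ _ iX) -(side _ _ jX).
by apply/idP/idP; apply: sep.
Qed.

(** An edge deleted by the consolidation has both ends merged into the same
    vertex, so images stay connected without it. Disjointness of the family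
    ensures that such an edge is merged by the set that contains it. *)
Lemma consolidate_immersion (G H : mgraph) (I : finType) (Z : I -> {set G})
    (theta : immersion H G) :
  (forall i j, i != j -> [disjoint Z i & Z j]) ->
  (forall e : edge H, ~~ is_loop e) -> strong theta ->
  (forall v i, im_vertex theta v \notin Z i) ->
  contains_strong_immersion (consolidate Z) H.
Proof.
move=> disj no_loop strong_theta outside.
have label v : cons_label Z (im_vertex theta v) = inl (im_vertex theta v).
  rewrite /cons_label; case: pickP => // i; by rewrite (negPf (outside v i)).
have label_inv v x : cons_label Z x = inl (im_vertex theta v) -> x = im_vertex theta v.
  by rewrite /cons_label; case: pickP => // _ [].
pose sV e := cons_proj Z @: sgV (im_edge theta e) : {set consolidate Z}.
pose sE e := [set f : edge (consolidate Z) | val f \in sgE (im_edge theta e)].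
have closedS e f : f \in sE e -> src f \in sV e /\ tgt f \in sV e.
  by rewrite inE => /sg_closed[fs ft]; split; apply: imset_f.
pose im e := Subgraph (closedS e).
pose imv v : consolidate Z := cons_proj Z (im_vertex theta v).
have imv_inj : injective imv.
  move=> u v /(congr1 val) /=; rewrite !label => -[]; exact: im_vertex_inj.
have im_conn e : sg_connected (im e).
  have [/set0Pn[x xS] conn] := im_edge_connected theta e; split.
    by apply/set0Pn; exists (cons_proj Z x); apply: imset_f.
  move=> _ _ /imsetP[y yS ->] /imsetP[z zS ->].
  have /connectP[p pth ->] := conn y z yS zS.
  elim: p y {yS} pth => [|w p IHp] y /=; first by rewrite connect0.
  move=> /andP[/adj_inP[yS wS [f fE ends]] /IHp]; apply: connect_trans.
  have [/existsP[i fi]|kept] := boolP [exists i, (src f \in Z i) && (tgt f \in Z i)].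
  - have lab v : v \in Z i -> cons_label Z v = inr i.
      rewrite /cons_label; case: pickP => [j vj|->] // vi.
      by have [->|/disj/disjointFr/(_ vj)] := eqVneq j i; last rewrite vi.
    have -> : cons_proj Z y = cons_proj Z w; last exact: connect0.
    move: fi => /andP[/lab labs /lab labt].
    by apply: val_inj; case: ends => -[<- <-]; rewrite /= labs labt.
  - pose f' : edge (consolidate Z) := exist _ f kept.
    apply: connect1.
    by case: ends => -[<- <-]; [|rewrite adj_in_sym];
      apply: (@adj_in_ends (consolidate Z) _ _ f');
      rewrite ?inE //; apply: imset_f; have [] := sg_closed fE.
have im_disj e f : e != f -> [disjoint sgE (im e) & sgE (im f)].
  move/(im_edge_disjoint theta)/pred0P => disjE; apply/pred0P => g.
  by have := disjE (val g); rewrite /= !inE.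
have im_inc e v : incident e v -> imv v \in sgV (im e).
  by move/(im_incident theta) => vE; apply: imset_f.
have im_lp e v : is_loop e -> incident e v ->
    exists C : subgraph (consolidate Z),
      [/\ sg_cycle C, sg_sub C (im e) & imv v \in sgV C].
  by move=> loop; have := no_loop e; rewrite loop.
exists (Immersion imv_inj im_conn im_disj im_inc im_lp) => e v ev /=.
apply/imsetP => -[x xE /(congr1 val) /=]; rewrite label => /esym/label_inv xv.
by have := strong_theta e v ev; rewrite -xv xE.
Qed.

(** The vertex sets consolidated in the torso at [t] come from components of
    [T - t], so they avoid [X t]. *)
Lemma torso_immersion n (G T : mgraph) (X : T -> {set G}) (t : T)
    (theta : immersion (complete_graph n) G) :
  near_partition X [set: G] -> strong theta ->
  (forall i, im_vertex theta i \in X t) ->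
  contains_strong_immersion (torso X t) (complete_graph n).
Proof.
move=> part strong_theta inXt; rewrite /torso; case: ifP => _; first by exists theta.
pose adj := adj_in [set~ t] [set: edge T].
have adj_sym := sym_connect_sym (adj_in_sym [set~ t] [set: edge T]).
apply: consolidate_immersion strong_theta _.
- move=> [C C_comp] [C' C'_comp]; rewrite -val_eqE /= => CC'.
  apply/pred0P => v /=; apply/negP => /andP[/bigcupP[r rC vr] /bigcupP[r' rC' vr']].
  have {}rC : r \in C by []; have {}rC' : r' \in C' by [].
  case/eqP: CC'; move: C_comp C'_comp rC rC' => /imsetP[x _ ->] /imsetP[x' _ ->].
  rewrite !inE (near_partition_eq part vr' vr) => xr x'r.
  apply/setP => y; rewrite !inE.
  by rewrite (same_connect adj_sym xr) (same_connect adj_sym x'r).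
- by move=> [[i j] ij]; rewrite /is_loop /= -val_eqE neq_ltn ij.
- move=> i [C C_comp]; apply/bigcupP => -[r rC vr].
  have {}rC : r \in C by []; have rt := near_partition_eq part vr (inXt i).
  move: C_comp rC => /imsetP[x xt ->]; rewrite inE rt => xt'.
  have closed_t : closed adj [set~ t] by move=> u v /adj_inP[-> ->].
  have := closed_connect closed_t xt'.
  by rewrite xt !inE eqxx.
Qed.

(** * Complete graphs excluded by basic torsos *)

Theorem theorem11 :
  forall alpha : nat, 1 <= alpha ->
  exists n : nat, 1 <= n /\
    forall (G T : mgraph) (X : vertex T -> {set vertex G}),
      tree_cut_decomposition X ->
      adhesion X < alpha ->
      (forall t : vertex T, basic alpha (torso X t)) ->
      ~ contains_strong_immersion G (complete_graph n).
Proof.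
move=> alpha alpha_gt0; pose n := 2 * alpha ^ 2 + 2 * alpha + 3.
have n_gt0 : 0 < n by rewrite /n; lia.
exists n; split=> // G T X dec small basicX [theta strong_theta].
have [_ part] := dec; pose i0 : 'I_n := Ordinal n_gt0.
have [t _ i0t] : exists2 t, true & im_vertex theta i0 \in X t.
  by apply/bigcupP; rewrite part.2.
have inXt i : im_vertex theta i \in X t.
  have /bigcupP[s _ iXs] : im_vertex theta i \in \bigcup_t X t by rewrite part.2.
  by rewrite (branch_same_bag dec _ i0t iXs) // /n; lia.
exact: basic_no_immersion (leqnn n) (basicX t)
  (torso_immersion part strong_theta inXt).
Qed.
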